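(* Let $H:\mathbb{R}\to\mathbb{R}$ be a continuous, 1-periodic, positive, translation-even function. Then $$\big\langle[\![H^{-1}]\!]\cdot[\![\,[\![H^{-2}]\!]\,]\!]\big\rangle=0,$$ and for every positive integer $k$, $$\big\langle H^{-1}\cdot[\![H^{-k}]\!]\big\rangle=0 .$$
   Context: For a continuous 1-periodic function $g:\mathbb{R}\to\mathbb{R}$ define its average over one period $\langle g\rangle:=\int_0^1 g(y)\,dy$, its fluctuating part $\{g\}(y):=g(y)-\langle g\rangle$, and, for all $y\in\mathbb{R}$, $$[\![g]\!](y):=\int_0^y\{g\}(\xi)\,d\xi-\int_0^1\int_0^\tau\{g\}(\xi)\,d\xi\,d\tau .$$ Powers such as $H^{-k}$ are pointwise. A 1-periodic function $f$ is called translation-even if there exists $\sigma\in(0,1)$ such that the shifted function $f_\sigma(y):=f(y-\sigma)$ satisfies $f_\sigma(y)=f_\sigma(1-y)$ for all $y\in[0,1]$. *)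

(* Defs.v *)
(* Stdlib real numbers with Coquelicot's Riemann integral. *)
From Stdlib Require Import Reals.
From Coquelicot Require Import Coquelicot.
Open Scope R_scope.

(* [RInt] is total, so the operators below are defined on every function; they
   have their intended meaning on Riemann-integrable functions, in particular
   on continuous ones. *)

Definition periodic1 (g : R -> R) : Prop := forall y, g (y + 1) = g y.

Definition average (g : R -> R) : R := RInt g 0 1.

Definition fluct (g : R -> R) (y : R) : R := g y - average g.

(* For y < 0, [RInt _ 0 y] is the oriented integral. *)
Definition fluct_prim (g : R -> R) (y : R) : R :=
  RInt (fluct g) 0 y - RInt (fun tau => RInt (fluct g) 0 tau) 0 1.

Definition shift (sigma : R) (f : R -> R) (y : R) : R := f (y - sigma).

Definition translation_even (f : R -> R) : Prop :=
  exists sigma, 0 < sigma < 1 /\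
    forall y, 0 <= y <= 1 -> shift sigma f y = shift sigma f (1 - y).

Notation "⟨ g ⟩" := (average g) (at level 0, g at level 200).
Notation "⟦ g ⟧" := (fluct_prim g) (at level 0, g at level 200).

(* Main.v *)
(* Translation-evenness and periodicity give a reflection symmetry
   [H (c - z) = H z] for all [z].  The bracket exchanges functions that are even
   and odd under [z -> c - z], and a periodic function that is odd under this
   reflection has average zero.  Both integrands are odd. *)
Require Import Defs.
From Stdlib Require Import Reals Lra ZArith.
From Coquelicot Require Import Coquelicot.
Open Scope R_scope.

Lemma ex_RInt_continuous_everywhere (f : R -> R) (a b : R) :
  (forall y, continuous f y) -> ex_RInt f a b.
Proof.
  intros Hf; apply (ex_RInt_continuous (V := R_CompleteNormedModule)); auto.
Qed.

(** Substitution with the factor [u] pulled out of the integral: [u = -1] yields reflections and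
    [u = 1] yields translation by a period. *)
Lemma RInt_lin (f : R -> R) (u v a b : R) :
  (forall y, continuous f y) ->
  u * RInt (fun y => f (u * y + v)) a b = RInt f (u * a + v) (u * b + v).
Proof.
  intros Hf.
  rewrite <- (RInt_comp_lin f u v a b)
    by now apply ex_RInt_continuous_everywhere.
  symmetry; apply (RInt_scal (V := R_CompleteNormedModule)
                     (fun y => f (u * y + v)) a b u).
  apply ex_RInt_continuous_everywhere; intros y.
  apply (continuous_comp (fun y => u * y + v) f); [| apply Hf].
  apply (ex_derive_continuous (fun y => u * y + v)); auto_derive; trivial.
Qed.

Lemma RInt_reflect (f : R -> R) (c a b : R) :
  (forall y, continuous f y) ->
  RInt (fun y => f (c - y)) a b = - RInt f (c - a) (c - b).
Proof.
  intros Hf.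
  replace (c - a) with (-1 * a + c) by ring.
  replace (c - b) with (-1 * b + c) by ring.
  rewrite <- (RInt_lin f (-1) c a b Hf).
  rewrite (RInt_ext (fun y => f (c - y)) (fun y => f (-1 * y + c))).
  - lra.
  - intros y _; apply f_equal; ring.
Qed.

Lemma RInt_split (f : R -> R) (a b c : R) :
  (forall y, continuous f y) -> RInt f a c = RInt f a b + RInt f b c.
Proof.
  intros Hf; symmetry.
  apply (RInt_Chasles (V := R_CompleteNormedModule) f);
    now apply ex_RInt_continuous_everywhere.
Qed.

(** By periodicity the integrals over [[0, a]] and [[1, a + 1]] agree. Splitting the integral from 0
    to [a + 1] at [a] and at 1 then leaves equal remainders. *)
Lemma RInt_period (f : R -> R) (a : R) :
  (forall y, continuous f y) -> periodic1 f -> RInt f a (a + 1) = average f.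
Proof.
  intros Hf Hp; unfold average.
  assert (E : RInt f 0 a = RInt f 1 (a + 1)).
  { pose proof (RInt_lin f 1 1 0 a Hf) as L.
    replace (1 * 0 + 1) with 1 in L by ring.
    replace (1 * a + 1) with (a + 1) in L by ring.
    rewrite <- L, Rmult_1_l; apply RInt_ext; intros y _.
    now rewrite Rmult_1_l, Hp. }
  pose proof (RInt_split f 0 a (a + 1) Hf).
  pose proof (RInt_split f 0 1 (a + 1) Hf).
  lra.
Qed.

(** The reflection carries [[0, 1]] onto [[c - 1, c]], again a full period; its sign is absorbed by
    the reversed orientation. *)
Lemma average_reflect (f : R -> R) (c : R) :
  (forall y, continuous f y) -> periodic1 f ->
  average (fun y => f (c - y)) = average f.
Proof.
  intros Hf Hp; unfold average at 1; rewrite RInt_reflect by assumption.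
  pose proof (RInt_period f (c - 1) Hf Hp) as E.
  replace (c - 1 + 1) with c in E by ring.
  rewrite <- E, Rminus_0_r.
  exact (opp_RInt_swap f _ _ (ex_RInt_continuous_everywhere f c (c - 1) Hf)).
Qed.

Lemma average_scal (f : R -> R) (s : R) :
  (forall y, continuous f y) -> average (fun y => s * f y) = s * average f.
Proof.
  intros Hf; apply (RInt_scal (V := R_CompleteNormedModule) f 0 1 s).
  now apply ex_RInt_continuous_everywhere.
Qed.

Lemma average_minus_const (f : R -> R) (k : R) :
  (forall y, continuous f y) -> average (fun y => f y - k) = average f - k.
Proof.
  intros Hf; unfold average.
  transitivity (RInt f 0 1 - RInt (fun _ => k) 0 1).
  - apply (RInt_minus (V := R_CompleteNormedModule) f (fun _ => k));
      [now apply ex_RInt_continuous_everywhere | apply ex_RInt_const].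
  - rewrite RInt_const; unfold scal; simpl; unfold mult; simpl; ring.
Qed.

(** The factor [s] treats both parities at once: [s = 1] is evenness and [s = -1] oddness about
    [c / 2]. *)
Lemma average_reflect_scal (f : R -> R) (c s : R) :
  (forall y, continuous f y) -> periodic1 f ->
  (forall y, f (c - y) = s * f y) -> average f = s * average f.
Proof.
  intros Hf Hp Hs.
  rewrite <- (average_reflect f c Hf Hp) at 1.
  rewrite <- average_scal by assumption.
  apply RInt_ext; intros y _; apply Hs.
Qed.

Lemma average_odd (f : R -> R) (c : R) :
  (forall y, continuous f y) -> periodic1 f ->
  (forall y, f (c - y) = - f y) -> average f = 0.
Proof.
  intros Hf Hp Ho.
  enough (average f = -1 * average f) by lra.
  apply (average_reflect_scal f c); trivial.
  intros y; rewrite Ho; ring.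
Qed.

Lemma continuous_minus_const (f : R -> R) (k y : R) :
  continuous f y -> continuous (fun x => f x - k) y.
Proof.
  intros Hf; apply (continuous_minus (V := R_NormedModule) f (fun _ => k));
    [assumption | apply continuous_const].
Qed.

Lemma continuous_fluct (f : R -> R) :
  (forall y, continuous f y) -> forall y, continuous (fluct f) y.
Proof. intros Hf y; now apply continuous_minus_const. Qed.

Lemma periodic1_fluct (f : R -> R) : periodic1 f -> periodic1 (fluct f).
Proof. intros Hp y; unfold fluct; now rewrite Hp. Qed.

Lemma average_fluct (f : R -> R) :
  (forall y, continuous f y) -> average (fluct f) = 0.
Proof.
  intros Hf; unfold fluct; rewrite average_minus_const by assumption; ring.
Qed.

Lemma continuous_primitive (f : R -> R) (a : R) :
  (forall y, continuous f y) -> forall y, continuous (fun t => RInt f a t) y.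
Proof.
  intros Hf y; apply (ex_derive_continuous (fun t => RInt f a t)).
  exists (f y); apply (is_derive_RInt f (fun t => RInt f a t) a y); [| apply Hf].
  (* Any radius serves, since the integral exists for every endpoint [t]. *)
  exists (mkposreal 1 Rlt_0_1); intros t _.
  apply (RInt_correct (V := R_CompleteNormedModule)); now apply ex_RInt_continuous_everywhere.
Qed.

Lemma continuous_fluct_prim (f : R -> R) :
  (forall y, continuous f y) -> forall y, continuous (fluct_prim f) y.
Proof.
  intros Hf y.
  apply (continuous_minus_const (fun t => RInt (fluct f) 0 t)).
  now apply continuous_primitive, continuous_fluct.
Qed.

(** The increment of the primitive over one period is the average of [fluct f], which is zero. *)
Lemma periodic1_fluct_prim (f : R -> R) :
  (forall y, continuous f y) -> periodic1 f -> periodic1 (fluct_prim f).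
Proof.
  intros Hf Hp y; unfold fluct_prim.
  rewrite (RInt_split (fluct f) 0 y (y + 1)) by now apply continuous_fluct.
  rewrite RInt_period, average_fluct;
    auto using continuous_fluct, periodic1_fluct; ring.
Qed.

Lemma average_fluct_prim (f : R -> R) :
  (forall y, continuous f y) -> average (fluct_prim f) = 0.
Proof.
  intros Hf; unfold fluct_prim.
  rewrite (average_minus_const (fun y => RInt (fluct f) 0 y));
    [apply Rminus_diag | now apply continuous_primitive, continuous_fluct].
Qed.

(* Reflecting the integral gives the identity up to an additive constant, which
   vanishes because [fluct_prim f] has average zero. *)
Lemma fluct_prim_reflect (f : R -> R) (c s : R) :
  (forall y, continuous f y) -> periodic1 f ->
  (forall y, f (c - y) = s * f y) ->
  forall y, fluct_prim f (c - y) = - s * fluct_prim f y.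
Proof.
  intros Hf Hp Hs.
  (* Subtracting the average keeps the factor [s], because the average itself satisfies
     [average f = s * average f]. *)
  assert (Hfl : forall y, fluct f (c - y) = s * fluct f y).
  { intros y; unfold fluct.
    pose proof (average_reflect_scal f c s Hf Hp Hs).
    rewrite Hs; lra. }
  pose proof (continuous_fluct f Hf) as Cfl.
  pose proof (continuous_fluct_prim f Hf) as CP.
  assert (HK : exists K, forall y, fluct_prim f (c - y) - K = - s * fluct_prim f y).
  { set (m := RInt (fun tau => RInt (fluct f) 0 tau) 0 1).
    (* With [F] the primitive of [fluct f] from 0, reflection gives [F (c - y) = F c - s * F y]; the
       two mean values [m] supply the rest of the constant. *)
    exists (RInt (fluct f) 0 c - m - s * m); intros y; unfold fluct_prim; fold m.
    rewrite (RInt_split (fluct f) 0 c (c - y)) by assumption.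
    pose proof (RInt_reflect (fluct f) c 0 y Cfl) as E.
    rewrite Rminus_0_r in E.
    assert (E' : RInt (fun t => fluct f (c - t)) 0 y = s * RInt (fluct f) 0 y).
    { rewrite (RInt_ext _ (fun t => s * fluct f t)) by (intros; apply Hfl).
      apply (RInt_scal (V := R_CompleteNormedModule) (fluct f) 0 y s).
      now apply ex_RInt_continuous_everywhere. }
    lra. }
  destruct HK as [K HK].
  assert (CPr : forall y, continuous (fun t => fluct_prim f (c - t)) y).
  { intros y; apply (continuous_comp (fun t => c - t) (fluct_prim f)); [| apply CP].
    apply (ex_derive_continuous (fun t => c - t)); auto_derive; trivial. }
  assert (K0 : K = 0).
  { assert (E : average (fun y => fluct_prim f (c - y) - K)
                = average (fun y => - s * fluct_prim f y))
      by (apply RInt_ext; intros; apply HK).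
    rewrite (average_minus_const (fun t => fluct_prim f (c - t))), average_reflect,
      average_scal, average_fluct_prim in E; auto using periodic1_fluct_prim.
    lra. }
  intros y; rewrite <- HK, K0; ring.
Qed.

Lemma periodic1_Z (f : R -> R) (n : Z) (y : R) :
  periodic1 f -> f (y + IZR n) = f y.
Proof.
  intros Hp; revert y; induction n as [| n IH | n IH] using Z.peano_ind; intros y.
  - now rewrite Rplus_0_r.
  - rewrite succ_IZR, <- Rplus_assoc, Hp; apply IH.
  - rewrite <- (Hp (y + _)), <- (IH y); f_equal.
    rewrite <- Z.sub_1_r, minus_IZR; ring.
Qed.

(** Putting [z = y + sigma] in [f (z - sigma) = f (1 - z - sigma)] shows that [c = 1 - 2 * sigma].
    The hypothesis covers only [z] in [[0, 1]]; periodicity extends it to all reals. *)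
Lemma translation_even_reflect (f : R -> R) :
  periodic1 f -> translation_even f -> exists c, forall y, f (c - y) = f y.
Proof.
  intros Hp [sigma [_ He]]; exists (1 - 2 * sigma); intros y.
  (* Subtracting [n] brings [y + sigma] into [[0, 1]]. It shifts the two arguments of [f] by [- n]
     and [n], which periodicity removes. *)
  set (n := Int_part (y + sigma)).
  destruct (base_Int_part (y + sigma)) as [H1 H2]; fold n in H1, H2.
  assert (Hz : 0 <= y + sigma - IZR n <= 1) by lra.
  specialize (He _ Hz); unfold Defs.shift in He.
  replace (y + sigma - IZR n - sigma) with (y + IZR (- n)) in He
    by (rewrite opp_IZR; ring).
  replace (1 - (y + sigma - IZR n) - sigma) with (1 - 2 * sigma - y + IZR n) in He
    by ring.
  now rewrite !(periodic1_Z f) in He.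
Qed.

Lemma continuous_inv_pow (f : R -> R) (k : nat) :
  (forall y, continuous f y) -> (forall y, 0 < f y) ->
  forall y, continuous (fun x => / (f x ^ k)) y.
Proof.
  intros Hf Hpos y.
  apply (continuous_comp f (fun t => / (t ^ k))); [apply Hf |].
  apply (ex_derive_continuous (fun t => / (t ^ k))); auto_derive.
  apply pow_nonzero, Rgt_not_eq, Hpos.
Qed.

Theorem proposition9 (H : R -> R)
  (Hcont : forall y, continuous H y)
  (Hper : periodic1 H)
  (Hpos : forall y, 0 < H y)
  (Heven : translation_even H) :
  ⟨ fun y => ⟦ fun x => / (H x) ⟧ y * ⟦ ⟦ fun x => / (H x ^ 2) ⟧ ⟧ y ⟩ = 0
  /\ forall k : nat, (0 < k)%nat ->
       ⟨ fun y => / (H y) * ⟦ fun x => / (H x ^ k) ⟧ y ⟩ = 0.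
Proof.
  destruct (translation_even_reflect H Hper Heven) as [c Hc].
  assert (C : forall k y, continuous (fun x => / (H x ^ k)) y)
    by (intros k; now apply continuous_inv_pow).
  assert (P : forall k, periodic1 (fun x => / (H x ^ k)))
    by (intros k y; now rewrite Hper).
  assert (C1 : forall y, continuous (fun x => / H x) y).
  { intros y; apply (continuous_ext (fun x => / (H x ^ 1))); [| apply C].
    intros x; now rewrite pow_1. }
  assert (P1 : periodic1 (fun x => / H x)) by (intros y; now rewrite Hper).
  (* Powers of [H] are even, so [s = 1] and the bracket is odd. Writing [- (1)] matches [- s]
     syntactically, whereas [-1] would be an integer literal. *)
  assert (O1 : forall y, ⟦ fun x => / H x ⟧ (c - y) = - (1) * ⟦ fun x => / H x ⟧ y).
  { apply fluct_prim_reflect; trivial; intros y; rewrite Hc; ring. }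
  assert (O : forall k y, ⟦ fun x => / (H x ^ k) ⟧ (c - y)
                          = - (1) * ⟦ fun x => / (H x ^ k) ⟧ y).
  { intros k; apply fluct_prim_reflect; trivial; intros y; rewrite Hc; ring. }
  split.
  - apply (average_odd _ c).
    + intros y; apply (continuous_mult (K := R_AbsRing)); auto using continuous_fluct_prim.
    + intros y; rewrite !periodic1_fluct_prim;
        auto using continuous_fluct_prim, periodic1_fluct_prim.
    (* The inner bracket is odd, so the outer one is taken with [s = - (1)] and is even; the product
       of odd and even is odd. *)
    + intros y; rewrite O1, (fluct_prim_reflect _ c (- (1)));
        auto using continuous_fluct_prim, periodic1_fluct_prim; ring.
  - intros k _; apply (average_odd _ c).
    + intros y; apply (continuous_mult (K := R_AbsRing)); auto using continuous_fluct_prim.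
    + intros y; now rewrite Hper, periodic1_fluct_prim.
    (* Here the first factor is even and the bracket is odd. *)
    + intros y; rewrite Hc, O; ring.
Qed.
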